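(* Let $H$ be a real Hilbert space, $C\subseteq H$ a nonempty, convex and closed set, and $F:H\to H$ an operator which is $\gamma$-strongly pseudo-monotone on $C$ with $\gamma>0$ and Lipschitz continuous with constant $L>0$. Let $0<\lambda<\frac1L$ and $(\rho_n)_{n\ge0}\subseteq[0,1]$. Let $x_0\in H$ and let, for all $n\ge0$, $$y_n=P_C(x_n-\lambda F(x_n)),\qquad x_{n+1}=\rho_n\left(y_n+\lambda(F(x_n)-F(y_n))\right)+(1-\rho_n)x_n,$$ and assume that $x_n\ne y_n$ and $F(y_n)\neq0$ for every $n\ge0$. Let $x^*$ be the unique solution of $\mathrm{VI}(F,C)$. Then $$\|x_{n+1}-x^*\|\le\delta_n\|x_n-x^*\|\quad\forall n\ge0,$$ where $$\delta_n:=\left(1-\rho_n\left(1-\lambda^2L^2\right)\left(\frac{\lambda\gamma}{1+\lambda L+\lambda\gamma}\right)^2\right)^{1/2}\in(0,1).$$ In addition, if $\liminf_{n\to+\infty}\rho_n>0$, then the sequence $(x_n)_{n\ge0}$ converges linearly to $x^*$.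
   Context: $\mathrm{VI}(F,C)$ is the problem of finding $x^*\in C$ such that $\langle F(x^* ),x-x^*\rangle\ge 0$ for all $x\in C$. $P_C$ is the metric projection onto $C$. $F$ is $\gamma$-strongly pseudo-monotone on $C$ if for all $x,y\in C$: $\langle F(x),y-x\rangle\ge0\Rightarrow\langle F(y),y-x\rangle\ge\gamma\|x-y\|^2$. $F$ is Lipschitz continuous with constant $L$ if $\|F(x)-F(y)\|\le L\|x-y\|$ for all $x,y\in H$. It is known that under these assumptions $\mathrm{VI}(F,C)$ has a unique solution. ''$(x_n)$ converges linearly to $x^*$'' means that there exist $q\in(0,1)$ and $N\ge0$ with $\|x_{n+1}-x^*\|\le q\|x_n-x^*\|$ for all $n\ge N$. The iteration is Tseng's forward-backward-forward algorithm with relaxation parameters $(\rho_n)$; the algorithm stops if $y_n=x_n$ or $F(y_n)=0$, and the assumption that this never occurs means that it generates an infinite sequence.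
   Formalization: The claim δ_n ∈ (0,1) fails when ρ_n = 0 (then δ_n = 1); it is stated instead as 0 < δ_n ≤ 1 for all n, with δ_n < 1 whenever ρ_n > 0. *)

(* Defs.v *)
From HB Require Import structures.
From mathcomp Require Import all_boot all_order all_algebra sesquilinear.
From mathcomp Require Import all_classical all_reals all_analysis.
Import Order.TTheory GRing.Theory Num.Theory.
Import numFieldNormedType.Exports.

Set Implicit Arguments.
Unset Strict Implicit.
Unset Printing Implicit Defensive.

Local Open Scope classical_set_scope.
Local Open Scope ring_scope.

(* A real Hilbert space is a Banach space over R whose norm comes from a
   positive definite symmetric bilinear form. *)
HB.mixin Record CompleteNormedModule_isHilbert (R : realType) (H : Type)
    of CompleteNormedModule R H := {
  inner : {dot H for @idfun R};
  innerxx : forall x : H, inner x x = `|x| ^+ 2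
}.

#[short(type="hilbertType")]
HB.structure Definition Hilbert (R : realType) :=
  {H of CompleteNormedModule_isHilbert R H & CompleteNormedModule R H}.

Notation "''<[' x , y ]>" := (inner x y)
  (x, y at level 99, format "''<[' x ,  y ]>") : ring_scope.

Section VariationalInequality.
Context {R : realType} {H : hilbertType R}.
Implicit Types (F : H -> H) (C : set H) (x y : H).

Definition VI_solution F C x := C x /\ forall y, C y -> 0 <= '<[F x, y - x]>.

Definition strongly_pseudo_monotone (gamma : R) F C :=
  forall x y, C x -> C y -> 0 <= '<[F x, y - x]> ->
    gamma * `|x - y| ^+ 2 <= '<[F y, y - x]>.

(* The default value 0 is only taken when no nearest point exists, hence never
   when C is nonempty, closed and convex; the nearest point is then unique. *)
Definition metric_proj C x : H :=
  xget 0 [set p | C p /\ forall z, C z -> `|x - p| <= `|x - z|].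

Definition converges_linearly (u : nat -> H) (l : H) :=
  exists (q : R) (N : nat), 0 < q < 1 /\
    forall n, (N <= n)%N -> `|u n.+1 - l| <= q * `|u n - l|.

End VariationalInequality.

Definition contraction_factor {R : realType} (lambda L gamma rho : R) : R :=
  Num.sqrt (1 - rho * (1 - lambda ^+ 2 * L ^+ 2) *
    (lambda * gamma / (1 + lambda * L + lambda * gamma)) ^+ 2).

(* Main.v *)
(* Write p = P_C(x - lambda F x) and e = p - x*. The obtuse-angle property of
   the projection and strong pseudo-monotonicity at x* give
   lambda gamma |e|^2 <= <x - p, e> - lambda <F x - F p, e>. With the Lipschitz
   bound this yields, first, lambda gamma |e| <= (1 + lambda L) |x - p|, hence
   |x - p| >= kappa |x - x*| with
   kappa = lambda gamma / (1 + lambda L + lambda gamma), and, second, for the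
   full step t = p + lambda (F x - F p),
   |t - x*|^2 <= |x - x*|^2 - (1 - lambda^2 L^2) |x - p|^2.
   Relaxation is then handled by convexity of the squared norm. *)
Require Import Defs.
From HB Require Import structures.
From mathcomp Require Import all_boot all_order all_algebra sesquilinear.
From mathcomp Require Import all_classical all_reals all_analysis.
From mathcomp Require Import ring lra.
Import Order.TTheory GRing.Theory Num.Theory.
Import numFieldNormedType.Exports.

Local Open Scope classical_set_scope.
Local Open Scope ring_scope.

(** * Norm identities and the metric projection in a Hilbert space *)

Section HilbertProjection.
Context {R : realType} {H : hilbertType R}.
Implicit Types (C : set H) (a b x p : H).

Lemma innerC a b : '<[a, b]> = '<[b, a]>.
Proof. by rewrite hermC/= expr0 mul1r. Qed.

Lemma innerZl (t : R) a b : '<[t *: a, b]> = t * '<[a, b]>.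
Proof. exact: linearZl_LR. Qed.

Lemma innerZr (t : R) a b : '<[a, t *: b]> = t * '<[a, b]>.
Proof. by rewrite innerC innerZl innerC. Qed.

Lemma convB (t : R) a b x :
  t *: a + (1 - t) *: b - x = t *: (a - x) + (1 - t) *: (b - x).
Proof.
rewrite !scalerBr addrACA -opprD -scalerDl.
by rewrite [t + _]addrC subrK scale1r.
Qed.

Lemma sqr_normD a b :
  `|a + b| ^+ 2 = `|a| ^+ 2 + 2 * '<[a, b]> + `|b| ^+ 2.
Proof. rewrite -!innerxx linearDl !linearDr /= (innerC b a); ring. Qed.

Lemma sqr_normB a b :
  `|a - b| ^+ 2 = `|a| ^+ 2 - 2 * '<[a, b]> + `|b| ^+ 2.
Proof. by rewrite sqr_normD linearNr normrN mulrN. Qed.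

Lemma sqr_normZ (t : R) a : `|t *: a| ^+ 2 = t ^+ 2 * `|a| ^+ 2.
Proof. by rewrite normrZ exprMn real_normK ?num_real. Qed.

(** Cauchy-Schwarz without absolute values, read off from the triangle inequality by expanding both
    squares. *)
Lemma inner_le_norm a b : '<[a, b]> <= `|a| * `|b|.
Proof.
have : `|a + b| ^+ 2 <= (`|a| + `|b|) ^+ 2.
  by rewrite ler_sqr ?nnegrE ?addr_ge0 ?ler_normD.
rewrite sqr_normD; lra.
Qed.

(** At [t = 2^-1] this is the parallelogram law behind the projection; for general [t] it handles
    the relaxation. *)
Lemma sqr_norm_conv (t : R) a b :
  `|t *: a + (1 - t) *: b| ^+ 2 =
  t * `|a| ^+ 2 + (1 - t) * `|b| ^+ 2 - t * (1 - t) * `|a - b| ^+ 2.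
Proof.
rewrite sqr_normB sqr_normD !sqr_normZ innerZl innerZr; ring.
Qed.

Lemma convex_set_conv C (t : R) a b :
  convex_set C -> 0 <= t <= 1 -> C a -> C b -> C (t *: a + (1 - t) *: b).
Proof.
move=> Cc /andP[t0 t1] Ca Cb.
have := Cc a b (Itv01 t0 t1); rewrite !inE; exact.
Qed.

(** A minimizing sequence is Cauchy by the parallelogram law, and its limit stays in the closed set
    [C]. *)
Lemma nearest_point_exists C x : C !=set0 -> convex_set C -> closed C ->
  exists p, C p /\ forall z, C z -> `|x - p| <= `|x - z|.
Proof.
move=> [c Cc] Cconv Ccl.
pose S := [set `|x - z| ^+ 2 | z in C].
have S_lb : lbound S 0 by move=> _ [z _ <-]; rewrite exprn_ge0.
have S_inf : has_inf S by split; [exists (`|x - c| ^+ 2), c | exists 0].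
have /choice[u uP] (n : nat) :
    exists u, C u /\ `|x - u| ^+ 2 < inf S + n.+1%:R^-1.
  have [|_ [u Cu <-] ?] := @inf_adherent _ S n.+1%:R^-1 _ S_inf;
    last by exists u.
  by rewrite invr_gt0.
have S_le z : C z -> inf S <= `|x - z| ^+ 2.
  by move=> Cz; apply: ge_inf; [exists 0|exists z].
(* The midpoint of [u m] and [u n] lies in [C], so its squared distance to [x] is at least [inf S];
   the parallelogram law turns this into a bound on the gap. *)
have u_dist m n : `|u m - u n| ^+ 2 <= 2 * (m.+1%:R^-1 + n.+1%:R^-1).
  have [[Cm Dm] [Cn Dn]] := (uP m, uP n).
  have := S_le _ (@convex_set_conv C 2^-1 _ _ Cconv _ Cm Cn).
  have -> : x - (2^-1 *: u m + (1 - 2^-1) *: u n) =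
            2^-1 *: (x - u m) + (1 - 2^-1) *: (x - u n).
    by rewrite -opprB convB -[x - u m]opprB -[x - u n]opprB !scalerN -opprD.
  rewrite sqr_norm_conv.
  rewrite (_ : x - u m - (x - u n) = - (u m - u n)) ?normrN; last first.
    by rewrite !opprB addrC addrA subrK.
  have half01 : 0 <= (2^-1 : R) <= 1 by apply/andP; split; lra.
  move=> /(_ half01).
  move: Dm Dn; set A := _ ^+ 2; set B := _ ^+ 2; set D := _ ^+ 2.
  set a := m.+1%:R^-1; set b := n.+1%:R^-1; set s := inf S.
  lra.
have : cvg (u @ \oo).
  apply/cauchy_cvgP/cauchyP => e e0.
  (* From [N] on the inverses are below [e ^+ 2 / 4], so [u_dist] gives a squared distance below
     [e ^+ 2]. *)
  have d0 : 0 < e ^+ 2 / 4 by rewrite divr_gt0 ?exprn_gt0.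
  have [N _ NP] := near_infty_natSinv_lt (PosNum d0).
  exists (u N), N => // n /= Nn.
  rewrite -ball_normE /= -ltr_sqr ?nnegrE ?(ltW e0) //.
  apply: (le_lt_trans (u_dist N n)).
  have /= := NP n Nn; have /= := NP N (leqnn N).
  set a := N.+1%:R^-1; set b := n.+1%:R^-1; lra.
move=> /cvg_ex[p up]; exists p.
have Cp : C p.
  apply: (closed_cvg (F := \oo)) up => //.
  by apply: nearW => n; have [] := uP n.
split => // z Cz.
have nup : `|x - u n| ^+ 2 @[n --> \oo] --> `|x - p| ^+ 2.
  have xup : `|x - u n| @[n --> \oo] --> `|x - p|.
    by apply: cvg_norm; apply: cvgB => //; exact: cvg_cst.
  by under eq_fun do rewrite expr2; rewrite expr2; exact: cvgM.
have Sn : inf S + harmonic n @[n --> \oo] --> inf S.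
  rewrite -[X in _ --> X]addr0; apply: cvgD; [exact: cvg_cst|].
  exact: cvg_harmonic.
rewrite -ler_sqr ?nnegrE //; apply: le_trans (S_le z Cz).
(* Passing to the limit in [uP] bounds the squared distance from [x] to [p] by [inf S]. *)
apply: ler_cvg_to nup Sn _; apply: nearW => n; apply: ltW.
by have [] := uP n.
Qed.

(** Existence of a nearest point rules out the default value of [xget]. *)
Lemma metric_proj_nearest C x : C !=set0 -> convex_set C -> closed C ->
  C (metric_proj C x) /\
  forall z, C z -> `|x - metric_proj C x| <= `|x - z|.
Proof.
move=> C0 Cconv Ccl.
have [p pP] := nearest_point_exists _ x C0 Cconv Ccl.
rewrite /metric_proj; case: xgetP => [q _ //|/(_ p)[]]; exact: pP.
Qed.

(* Compare the distances from x to p and to p + t(c - p): the inequality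
   2t<x - p, c - p> <= t^2 |c - p|^2 forces the inner product to be
   nonpositive for small t > 0. *)
Lemma metric_proj_obtuse C x c : C !=set0 -> convex_set C -> closed C -> C c ->
  '<[x - metric_proj C x, c - metric_proj C x]> <= 0.
Proof.
move=> C0 Cconv Ccl Cc.
have [Cp] := metric_proj_nearest _ x C0 Cconv Ccl.
set p := metric_proj C x in Cp * => p_le.
have small t : 0 < t <= 1 -> 2 * '<[x - p, c - p]> <= t * `|c - p| ^+ 2.
  move=> /andP[t0 t1].
  have /p_le : C (t *: c + (1 - t) *: p) by apply: convex_set_conv => //; lra.
  have -> : x - (t *: c + (1 - t) *: p) = (x - p) - t *: (c - p).
    by rewrite scalerBr scalerBl scale1r addrCA opprD addrA.
  rewrite -(@ler_sqr _ `|x - p|) ?nnegrE // (sqr_normB (x - p)).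
  rewrite sqr_normZ innerZr => h.
  rewrite -(ler_pM2l t0); lra.
rewrite leNgt; apply/negP => i0.
set i := '<[_, _]> in small i0.
have n0 : 0 <= `|c - p| ^+ 2 by rewrite exprn_ge0.
(* This [t] is at most 1 and makes [t * |c - p|^2 <= i], so [small] would give [2 * i <= i] with
   [i > 0]. *)
have t0 : 0 < i / (i + `|c - p| ^+ 2) by rewrite divr_gt0 // ltr_wpDr.
have := small (i / (i + `|c - p| ^+ 2)).
rewrite t0 ler_pdivrMr ?ltr_wpDr// mul1r lerDl n0 => /(_ isT).
apply/negP; rewrite -ltNge.
have h : i / (i + `|c - p| ^+ 2) * `|c - p| ^+ 2 <= i.
  rewrite mulrAC ler_pdivrMr ?ltr_wpDr//; nra.
lra.
Qed.

End HilbertProjection.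

(** * Bounds and monotonicity of the contraction factor *)

Section ContractionFactor.
Context {R : realType}.
Variables gamma L lambda : R.
Hypotheses (gamma_gt0 : 0 < gamma) (L_gt0 : 0 < L).
Hypotheses (lambda_gt0 : 0 < lambda) (lambdaL_lt1 : lambda * L < 1).

(** The full step contracts squared distances by [1 - rate]; averaging with weight [r] against the
    identity gives [1 - r * rate]. *)
Definition rate : R := (1 - lambda ^+ 2 * L ^+ 2) *
  (lambda * gamma / (1 + lambda * L + lambda * gamma)) ^+ 2.

Lemma contraction_factorE (r : R) :
  contraction_factor lambda L gamma r = Num.sqrt (1 - r * rate).
Proof. by rewrite /contraction_factor /rate (mulrA r). Qed.

Lemma rate_bounds : 0 < rate < 1.
Proof.
have lL : 0 < lambda * L by rewrite mulr_gt0.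
have lg : 0 < lambda * gamma by rewrite mulr_gt0.
have D0 : 0 < 1 + lambda * L + lambda * gamma by lra.
have k0 : 0 < lambda * gamma / (1 + lambda * L + lambda * gamma).
  by rewrite divr_gt0.
have k1 : lambda * gamma / (1 + lambda * L + lambda * gamma) < 1.
  by rewrite ltr_pdivrMr//; lra.
have lL2 : 0 < lambda ^+ 2 * L ^+ 2 < 1.
  by rewrite -exprMn exprn_gt0//= expr_lt1//; apply: ltW.
have [c0 c1] : 0 < 1 - lambda ^+ 2 * L ^+ 2 /\ 1 - lambda ^+ 2 * L ^+ 2 < 1.
  by split; lra.
apply/andP; split; first by rewrite mulr_gt0 ?exprn_gt0.
rewrite mulr_ilt1 ?exprn_ge0 ?expr_lt1//; exact: ltW.
Qed.

Lemma contraction_factor_gt0 (r : R) : 0 <= r <= 1 ->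
  0 < contraction_factor lambda L gamma r.
Proof.
case/andP: rate_bounds => s0 s1 /andP[r0 r1].
rewrite contraction_factorE sqrtr_gt0 subr_gt0; apply: le_lt_trans s1.
by rewrite ler_piMl// ltW.
Qed.

(** A lower bound on the relaxation parameters thus yields one factor valid for all of them. *)
Lemma contraction_factor_antimono (r r' : R) : r <= r' ->
  contraction_factor lambda L gamma r' <= contraction_factor lambda L gamma r.
Proof.
case/andP: rate_bounds => s0 s1 rr'.
by rewrite !contraction_factorE ler_wsqrtr// lerB// ler_wpM2r// ltW.
Qed.

Lemma contraction_factor_lt1 (r : R) : 0 < r ->
  contraction_factor lambda L gamma r < 1.
Proof.
case/andP: rate_bounds => s0 s1 r0.
by rewrite contraction_factorE -[ltRHS]sqrtr1 ltr_sqrt// gtrBl mulr_gt0.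
Qed.

End ContractionFactor.

(** Boundedness makes the infima of the tails converge to [limn_inf u]; a tail whose infimum is
    positive supplies [N], and that infimum is [c]. *)
Lemma limn_inf_gt0_eventually_ge {R : realType} (u : nat -> R) :
  (exists M, forall n, `|u n| <= M) -> 0 < limn_inf u ->
  exists c N, 0 < c /\ forall n, (N <= n)%N -> c <= u n.
Proof.
move=> [M uM] l0.
have ub : has_ubound (range u).
  by exists M => _ [n _ <-]; apply: le_trans (uM n); exact: ler_norm.
have lb : has_lbound (range u).
  by exists (- M) => _ [n _ <-]; have := uM n; rewrite ler_norml => /andP[].
have := cvg_infs_sup ub lb.
move=> il; have il' := cvg_lim (@Rhausdorff R) il.
rewrite /limn_inf il' in l0.
have [N _ NP] := cvgr_gt _ il _ l0.
exists (infs u N), N; split; first exact: (NP N (leqnn N)).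
move=> n Nn; apply: ge_inf; first exact: has_lbound_sdrop.
by exists n.
Qed.

(** * One step of the forward-backward-forward method *)

Section Tseng.
Context {R : realType} {H : hilbertType R}.
Variables (C : set H) (F : H -> H) (gamma L lambda : R).
Hypotheses (C_nonempty : C !=set0) (C_convex : convex_set C).
Hypotheses (C_closed : closed C).
Hypotheses (gamma_gt0 : 0 < gamma) (F_spm : strongly_pseudo_monotone gamma F C).
Hypotheses (L_gt0 : 0 < L) (F_lip : L.-lipschitz F).
Hypotheses (lambda_gt0 : 0 < lambda) (lambdaL_lt1 : lambda * L < 1).
Let kappa := lambda * gamma / (1 + lambda * L + lambda * gamma).
Let p x := metric_proj C (x - lambda *: F x).

Lemma fbf_inner_bound x xs : VI_solution F C xs ->
  lambda * gamma * `|p x - xs| ^+ 2 <=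
  '<[x - p x, p x - xs]> - lambda * '<[F x - F (p x), p x - xs]>.
Proof.
move=> [Cxs VIxs].
have [Cp _] := metric_proj_nearest _ (x - lambda *: F x)
  C_nonempty C_convex C_closed.
have obt := metric_proj_obtuse _ (x - lambda *: F x) _
  C_nonempty C_convex C_closed Cxs.
(* The premise of pseudo-monotonicity is the variational inequality tested at [p x]. *)
have spm := F_spm _ _ Cxs Cp (VIxs _ Cp).
rewrite -/(p x) in Cp obt spm.
move: spm; rewrite -(ler_pM2l lambda_gt0) (distrC xs) mulrA => spm.
move: obt; rewrite -(opprB (p x) xs) linearNr /= oppr_le0.
rewrite (addrAC x) !linearBl /= innerZl.
lra.
Qed.

Lemma fbf_residual_bound x xs :
  VI_solution F C xs -> kappa * `|x - xs| <= `|x - p x|.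
Proof.
move=> /(fbf_inner_bound x) h.
have Lip : `|F x - F (p x)| <= L * `|x - p x| by exact: (F_lip (x, p x)).
set a := x - p x in Lip h *; set e := p x - xs in h *.
set d := F x - _ in h Lip *.
have -> : x - xs = a + e by rewrite /a /e addrA subrK.
have e_le : lambda * gamma * `|e| <= (1 + lambda * L) * `|a|.
  (* The bound comes from cancelling one factor [|e|], hence the separate case of norm zero. *)
  have [->|e0] := eqVneq `|e| 0.
    by rewrite mulr0 mulr_ge0// addr_ge0 ?mulr_ge0 ?ltW.
  have e_gt0 : 0 < `|e| by rewrite lt_def e0 normr_ge0.
  rewrite -(ler_pM2r e_gt0) -(mulrA (lambda * gamma)) -(expr2 `|e|).
  apply: (le_trans h).
  have := inner_le_norm a e.
  have := inner_le_norm (- d) e; rewrite linearNl normrN /= => de ae.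
  have : - '<[d, e]> <= L * `|a| * `|e|.
    by apply: (le_trans de); rewrite ler_pM2r.
  rewrite -(ler_pM2l lambda_gt0); lra.
have D0 : 0 < 1 + lambda * L + lambda * gamma.
  by rewrite addr_gt0 ?mulr_gt0// addr_gt0 ?mulr_gt0.
rewrite /kappa mulrAC ler_pdivrMr//.
(* Adding [lambda * gamma * |a|] to the bound [e_le] produces the denominator of [kappa]. *)
have : lambda * gamma * `|a + e| <= lambda * gamma * (`|a| + `|e|).
  by rewrite ler_pM2l ?mulr_gt0// ler_normD.
lra.
Qed.

Lemma fbf_contraction x xs : VI_solution F C xs ->
  `|p x + lambda *: (F x - F (p x)) - xs| ^+ 2 <=
  (1 - (1 - lambda ^+ 2 * L ^+ 2) * kappa ^+ 2) * `|x - xs| ^+ 2.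
Proof.
move=> xsP; have h := fbf_inner_bound x _ xsP.
have : kappa ^+ 2 * `|x - xs| ^+ 2 <= `|x - p x| ^+ 2.
  rewrite -exprMn ler_sqr ?nnegrE ?fbf_residual_bound// mulr_ge0//.
  rewrite divr_ge0 ?ltW//.
  - by rewrite mulr_gt0.
  - by rewrite addr_gt0 ?mulr_gt0// addr_gt0 ?mulr_gt0.
have : `|F x - F (p x)| ^+ 2 <= L ^+ 2 * `|x - p x| ^+ 2.
  rewrite -exprMn ler_sqr ?nnegrE ?(mulr_ge0 (ltW L_gt0))//.
  exact: (F_lip (x, p x)).
have : 0 < 1 - lambda ^+ 2 * L ^+ 2
  by rewrite -exprMn subr_gt0 expr_lt1// mulr_ge0 ?ltW.
have : 0 <= lambda * gamma * `|p x - xs| ^+ 2.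
  by rewrite !mulr_ge0 ?exprn_ge0 // ltW.
rewrite (addrAC (p x)).
(* Twice the inner bound replaces [2 * lambda * <d, e>] by at most [2 * <a, e>], which together with
   [|e|^2] is [|a + e|^2 - |a|^2]. *)
have -> : x - xs = (x - p x) + (p x - xs) by rewrite addrA subrK.
move: h; set a := x - p x; set e := p x - xs; set d := F x - _ => h.
rewrite (sqr_normD a e) (sqr_normD e (lambda *: d)) sqr_normZ innerZr.
rewrite (innerC e d) => e0 c0 Lip k_le.
move: h Lip k_le e0 c0.
set A := `|a| ^+ 2; set E := `|e| ^+ 2; set B := `|d| ^+ 2.
set ae := '<[a, e]>; set de := '<[d, e]>; set c := 1 - lambda ^+ 2 * _.
move=> h; rewrite -(@ler_pM2l _ (lambda ^+ 2)) ?exprn_gt0// => Lip k_le e0 c0.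
have : c * (kappa ^+ 2 * (A + 2 * ae + E)) <= c * A.
  by rewrite ler_pM2l.
rewrite /c; lra.
Qed.

Lemma relaxed_fbf_contraction x xs (r : R) :
  VI_solution F C xs -> 0 <= r <= 1 ->
  `|r *: (p x + lambda *: (F x - F (p x))) + (1 - r) *: x - xs| <=
  contraction_factor lambda L gamma r * `|x - xs|.
Proof.
move=> xsP /andP[r0 r1]; rewrite convB.
have /andP[s0 s1] := rate_bounds _ _ _ gamma_gt0 L_gt0 lambda_gt0 lambdaL_lt1.
have rs1 : 0 <= 1 - r * rate gamma L lambda.
  by rewrite subr_ge0 mulr_ile1// ltW.
rewrite contraction_factorE -ler_sqr ?nnegrE ?mulr_ge0 ?sqrtr_ge0//.
rewrite exprMn sqr_sqrtr// sqr_norm_conv.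
have /(ler_wpM2l r0) := fbf_contraction x _ xsP.
rewrite -/(rate gamma L lambda).
set A := `|_ + _ - xs| ^+ 2; set B := `|x - xs| ^+ 2.
(* This is the term subtracted in [sqr_norm_conv]; it is dropped. *)
have : 0 <= r * (1 - r) *
    `|p x + lambda *: (F x - F (p x)) - xs - (x - xs)| ^+ 2.
  by rewrite !mulr_ge0 ?subr_ge0 ?exprn_ge0.
lra.
Qed.

End Tseng.

Theorem theorem3p4 (R : realType) (H : hilbertType R)
  (C : set H) (F : H -> H) (gamma L lambda : R)
  (rho : nat -> R) (x y : nat -> H) (xstar : H)
  (C_nonempty : C !=set0) (C_convex : convex_set C) (C_closed : closed C)
  (gamma_gt0 : 0 < gamma) (F_spm : strongly_pseudo_monotone gamma F C)
  (L_gt0 : 0 < L) (F_lip : L.-lipschitz F)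
  (lambda_bd : 0 < lambda < 1 / L)
  (rho_bd : forall n, 0 <= rho n <= 1)
  (y_def : forall n, y n = metric_proj C (x n - lambda *: F (x n)))
  (x_rec : forall n, x n.+1 =
    rho n *: (y n + lambda *: (F (x n) - F (y n))) + (1 - rho n) *: x n)
  (no_stop : forall n, x n <> y n /\ F (y n) <> 0)
  (xstar_sol : VI_solution F C xstar) :
  let delta n := contraction_factor lambda L gamma (rho n) in
  [/\ forall n, `|x n.+1 - xstar| <= delta n * `|x n - xstar|,
      forall n, 0 < delta n <= 1 /\ (0 < rho n -> delta n < 1)
    & 0 < limn_inf rho -> converges_linearly x xstar].
Proof.
move=> delta; case/andP: lambda_bd => lambda_gt0.
rewrite ltr_pdivlMr// => lambdaL_lt1.
have step n : `|x n.+1 - xstar| <= delta n * `|x n - xstar|.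
  by rewrite x_rec y_def; exact: relaxed_fbf_contraction.
split=> // [n|].
  rewrite contraction_factor_gt0//=; split; last exact: contraction_factor_lt1.
  have /andP[rho0 _] := rho_bd n.
  (* Comparison with relaxation parameter 0, where the factor is exactly 1; so strictness is claimed
     only for [0 < rho n]. *)
  apply: le_trans (contraction_factor_antimono _ _ _ _ _ _ _ _ _ rho0) _ => //.
  by rewrite /contraction_factor !mul0r subr0 sqrtr1.
have rho_norm : exists M, forall n, `|rho n| <= M.
  by exists 1 => n; have /andP[rho0 rho1] := rho_bd n; rewrite ger0_norm.
move=> /(limn_inf_gt0_eventually_ge _ rho_norm)[c [N [c0 cP]]].
(* Since [c <= rho n] from [N] on, the factor at [c] dominates every later [delta n];
   [c <= rho N <= 1] keeps it positive. *)
exists (contraction_factor lambda L gamma c), N.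
split=> [|n Nn].
  rewrite contraction_factor_lt1// contraction_factor_gt0//.
  by rewrite ltW//=; apply: le_trans (cP N (leqnn N)) _; case/andP: (rho_bd N).
apply: (le_trans (step n)); rewrite ler_wpM2r//.
exact/contraction_factor_antimono/cP.
Qed.
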